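(* Let $(X,\mathcal{F})$ be a set system. Then the following are equivalent. 1. $(X,\mathcal{F})$ is a well-graded family with additionality $2$. 2. For every $D\in\mathcal{F}$, the graph $G_{\mathcal{F}'}$ is a uniformly directed semitree, where $\mathcal{F}'=flip(\mathcal{F},D\rightarrow\emptyset)$. 3. For some $D\in\mathcal{F}$, the graph $G_{\mathcal{F}'}$ is a uniformly directed semitree, where $\mathcal{F}'=flip(\mathcal{F},D\rightarrow\emptyset)$. 4. The graph $G_{\mathcal{F}}$ is a semitree.
   Context: A set system $(X,\mathcal{F})$ is a finite set $X$ together with a nonempty family $\mathcal{F}$ of distinct subsets of $X$. Its one-inclusion graph $G_{\mathcal{F}}$ is the edge-labelled directed graph with one vertex $v_A$ for each $A\in\mathcal{F}$ and a directed edge from $v_A$ to $v_B$ with label $b$ whenever $B=A\cup\{b\}$ for some $b\in X\setminus A$. For directed graphs, connectedness, trees, cycles and distances refer to the underlying undirected graph (the distance is infinite if there is no path). The system is well-graded if $|A\triangle B|=d_{G_{\mathcal{F}}}(v_A,v_B)$ for all $A,B\in\mathcal{F}$. $x\in X$ is essential if there are $A,B\in\mathcal{F}$ with $x\in A$, $x\notin B$; $ess_{\mathcal{F}}(X)$ is the set of essential elements. The additionality is $|\mathcal{F}|-|ess_{\mathcal{F}}(X)|$. For $D\in\mathcal{F}$, $flip(\mathcal{F},D\rightarrow\emptyset)$ is the system on $X$ obtained by applying to $\mathcal{F}$ the bit-flip operation on $a$ for every $a\in D$, where bit-flip on $a$ replaces each member $C$ by $C\setminus\{a\}$ if $a\in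 C$ and by $C\cup\{a\}$ if $a\notin C$; i.e. it equals $\{C\triangle D:C\in\mathcal{F}\}$. A parallel-directed-labelled $C_4$ cycle is a labelled directed 4-cycle $a_1a_2a_3a_4$ in which the edges $a_1a_2$ and $a_4a_3$ have the same label and parallel directions (either $a_1\to a_2$ and $a_4\to a_3$, or $a_2\to a_1$ and $a_3\to a_4$), and similarly the edges $a_2a_3$ and $a_1a_4$ have the same label (different from the label of $a_1a_2$ and $a_4a_3$) and parallel directions (either $a_2\to a_3$ and $a_1\to a_4$, or the reverse of both). A labelled directed graph $G$ is a semitree if it consists of a parallel-directed-labelled $C_4$ cycle $a_1a_2a_3a_4$ with four (possibly empty) trees attached to the vertices $a_1,a_2,a_3,a_4$ respectively, such that the labels of edges outside the $C_4$ cycle are different from each other and from the labels of the $C_4$ cycle. A semitree $G$ is uniformly directed if either $G$ is itself a parallel-directed-labelled $C_4$ cycle or there is a vertex $o$ of $G$ such that for every edge $ab$ of $G$, the edge is directed from $a$ to $b$ if and only if $d_G(o,b)>d_G(o,a)$. *)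

(* Defs.v *)
From HB Require Import structures.
From mathcomp Require Import all_boot all_order all_algebra.

Set Implicit Arguments.
Unset Strict Implicit.
Unset Printing Implicit Defensive.

(* [arc u v = Some l] is the edge u -> v with label l.  The field [arc_asym]
   forbids loops and opposite edges, so the underlying graph is simple. *)
Record ldgraph (V L : finType) := LDGraph {
  arc : V -> V -> option L;
  arc_asym : forall u v, arc u v -> arc v u = None }.

Section LabelledDigraph.
Variables (V L : finType) (G : ldgraph V L).
Implicit Types (u v a b o : V) (S : {set V}).

Definition adj : rel V := [rel u v | arc G u v || arc G v u].

Definition walk (n : nat) u v : bool :=
  [exists p : n.-tuple V, path adj u p && (last u p == v)].

(* [None] is the infinite distance; a shortest walk has fewer than #|V| edges
   (see [dist_Some] and [dist_None]). *)
Definition dist u v : option nat :=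
  let n := find (fun n => walk n u v) (iota 0 #|V|) in
  if n < #|V| then Some n else None.

Definition dist_lt (d e : option nat) : bool :=
  match d, e with
  | Some i, Some j => i < j
  | Some _, None => true
  | None, _ => false
  end.

(* The subgraph induced on S is a tree; [size p > 2] excludes the degenerate
   cycles u, v, u of a symmetric relation. *)
Definition tree_on S : Prop :=
  {in S &, forall u v,
     connect [rel x y | [&& x \in S, y \in S & adj x y]] u v} /\
  (forall p : seq V, {subset p <= S} -> 2 < size p -> ~ ucycle adj p).

Definition parallel_edges (l : L) u v x y : Prop :=
  (arc G u v = Some l /\ arc G x y = Some l) \/
  (arc G v u = Some l /\ arc G y x = Some l).

Definition parallel_C4 a1 a2 a3 a4 (l m : L) : Prop :=
  [/\ uniq [:: a1; a2; a3; a4],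
      parallel_edges l a1 a2 a4 a3,
      parallel_edges m a2 a3 a1 a4
    & l != m].

Definition C4_edge a1 a2 a3 a4 u v : bool :=
  [set u; v] \in
    [:: [set a1; a2]; [set a2; a3]; [set a3; a4]; [set a4; a1]].

Definition is_parallel_C4 : Prop :=
  exists a1 a2 a3 a4 l m,
    [/\ parallel_C4 a1 a2 a3 a4 l m,
        forall v, v \in [:: a1; a2; a3; a4]
      & forall u v, arc G u v -> C4_edge a1 a2 a3 a4 u v].

(* [T a] is the tree attached at the cycle vertex a, with a itself included:
   an empty attached tree is [T a = [set a]], and a may have several
   neighbours in [T a]. *)
Definition semitree : Prop :=
  exists a1 a2 a3 a4 l m (T : V -> {set V}),
    let c := [:: a1; a2; a3; a4] in
    let outer u v (k : L) := arc G u v = Some k /\ ~~ C4_edge a1 a2 a3 a4 u v in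
    [/\ parallel_C4 a1 a2 a3 a4 l m,
        {in c, forall a, a \in T a /\ tree_on (T a)},
        {in c &, forall a b, a != b -> [disjoint T a & T b]} /\
          (forall v, exists2 a, a \in c & v \in T a),
        forall u v, arc G u v ->
          C4_edge a1 a2 a3 a4 u v \/
          (exists2 a, a \in c & (u \in T a) && (v \in T a))
      & (forall u v k, outer u v k -> k != l /\ k != m) /\
        (forall u v u' v' k, outer u v k -> outer u' v' k ->
           u = u' /\ v = v')].

Definition uniformly_directed : Prop :=
  is_parallel_C4 \/
  exists o, forall a b, adj a b ->
    (arc G a b <-> dist_lt (dist o a) (dist o b)).

Definition uniformly_directed_semitree : Prop :=
  semitree /\ uniformly_directed.

Lemma walkP n u v :
  reflect (exists p, [/\ size p = n, path adj u p & last u p = v])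
          (walk n u v).
Proof.
apply: (iffP existsP) => [[p /andP[pp /eqP lp]]|[p [sp pp lp]]].
  by exists p; rewrite size_tuple.
have sp' : size p == n by apply/eqP.
by exists (Tuple sp'); rewrite /= pp lp eqxx.
Qed.

Lemma walk_short n u v : walk n u v -> exists2 m, m < #|V| & walk m u v.
Proof.
case/walkP=> p [_ pp lp]; case: (shortenP pp) lp => q pq uq _ lq.
exists (size q); last by apply/walkP; exists q.
by have := max_card (mem (u :: q)); rewrite (card_uniqP uq).
Qed.

Lemma dist_Some n u v :
  dist u v = Some n <-> walk n u v /\ (forall m, walk m u v -> n <= m).
Proof.
rewrite /dist; set f := (fun n => walk n u v); set s := iota 0 #|V|.
have nth_s i : i < #|V| -> nth 0 s i = i by move=> lti; rewrite nth_iota.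
have sz : size s = #|V| by rewrite size_iota.
have before i : i < find f s -> f i = false.
  move=> lti; rewrite -(before_find 0 lti) nth_s //.
  by apply: (leq_trans lti); rewrite -sz find_size.
have hasV m : f m -> find f s < #|V|.
  case/walk_short=> k ltk fk; rewrite -sz -has_find.
  by apply/hasP; exists k => //; rewrite mem_iota.
split=> [|[wn minn]].
  case: ifP => // lt [<-]; split=> [|m fm].
    by have := @nth_find _ 0 f s; rewrite has_find sz lt nth_s //; apply.
  by rewrite leqNgt; apply/negP => /before; rewrite /f fm.
rewrite (hasV _ wn); congr Some; apply/eqP; rewrite eqn_leq; apply/andP; split.
  by rewrite leqNgt; apply/negP => /before; rewrite /f wn.
apply: minn; have := @nth_find _ 0 f s; rewrite has_find sz (hasV _ wn).
by rewrite nth_s ?(hasV _ wn) //; apply.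
Qed.

Lemma dist_None u v : dist u v = None <-> ~~ connect adj u v.
Proof.
have conn : connect adj u v <-> exists n, walk n u v.
  split=> [/connectP[p pp ->]|[n /walkP[p [_ pp <-]]]].
    by exists (size p); apply/walkP; exists p.
  by apply/connectP; exists p.
split=> [dN|/negP nc].
  apply/negP=> /conn /ex_minnP[m wm minm].
  by have : dist u v = Some m by [apply/dist_Some]; rewrite dN.
case E: (dist u v) => [n|] //; case: nc; apply/conn.
by exists n; case/dist_Some: E.
Qed.

End LabelledDigraph.

Section SetSystem.
Variable X : finType.
Implicit Types (F : {set {set X}}) (A B C D : {set X}) (a b x : X).

Definition symdiff A B : {set X} := (A :\: B) :|: (B :\: A).

Definition vertex F : finType := {A : {set X} | A \in F}.

Definition oig_arc F (u v : vertex F) : option X :=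
  [pick b | (b \notin val u) && (val v == b |: val u)].

Lemma oig_arcP F (u v : vertex F) b :
  oig_arc u v = Some b <-> b \notin val u /\ val v = b |: val u.
Proof.
rewrite /oig_arc; case: pickP => [c /andP[cu /eqP vE]|none]; last first.
  by split=> // -[bu vE]; have := none b; rewrite bu vE eqxx.
split=> [[<-] //|[bu vE']]; congr Some; apply/esym/eqP.
have : b \in val v by rewrite vE' setU11.
by rewrite vE in_setU1 (negPf bu) orbF.
Qed.

Lemma oig_arc_asym F (u v : vertex F) : oig_arc u v -> oig_arc v u = None.
Proof.
case E: (oig_arc u v) => [b|] // _; case/oig_arcP: E => bu vE.
case E': (oig_arc v u) => [c|] //; case/oig_arcP: E' => _ uE.
by case/negP: bu; rewrite uE vE !inE eqxx orbT.
Qed.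

Definition one_inclusion_graph F : ldgraph (vertex F) X :=
  LDGraph (@oig_arc_asym F).

Definition well_graded F : Prop :=
  forall u v : vertex F,
    dist (one_inclusion_graph F) u v = Some #|symdiff (val u) (val v)|.

Definition ess F : {set X} :=
  [set x | [exists A in F, x \in A] && [exists B in F, x \notin B]].

(* Integer-valued: #|F| may be smaller than #|ess F|. *)
Definition additionality F : int := (#|F|%:Z - #|ess F|%:Z)%R.

Definition bitflip a C : {set X} := if a \in C then C :\ a else a |: C.

Definition flip F D : {set {set X}} :=
  foldr (fun a (H : {set {set X}}) => [set bitflip a C | C in H]) F (enum D).

Lemma flipE F D : flip F D = [set symdiff C D | C in F].
Proof.
rewrite /flip.
have in_foldr s : uniq s ->
    foldr (fun a (H : {set {set X}}) => [set bitflip a C | C in H]) F s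
      = [set symdiff C [set y in s] | C in F].
  elim: s => [_|a s IH /=/andP[as_ us]].
    rewrite /= -[LHS]imset_id; apply: eq_imset => C.
    by apply/setP=> y; rewrite !inE andbF orbF.
  rewrite IH // -imset_comp; apply: eq_imset => C /=.
  apply/setP=> y; rewrite /bitflip fun_if !inE.
  have [->|ya] := eqVneq y a.
    by rewrite (negPf as_) /=; case: (a \in C); rewrite !inE eqxx.
  by case: ifP => _; rewrite !inE (negPf ya).
rewrite in_foldr ?enum_uniq //; apply: eq_imset => C; congr symdiff.
by apply/setP=> y; rewrite inE mem_enum.
Qed.

End SetSystem.

(* Main.v *)
(* Call [x] a label when some edge of the one-inclusion graph adds [x], and let
   [F / x] be the contraction of all these edges.  Well-gradedness survives the
   contraction, which removes one essential element and as many members as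
   there are x-edges.  By induction #|F| > #|ess F|, so that an essential
   element labels at most #|F| - #|ess F| edges.

   With additionality 2 some label [x] occurs exactly twice and [F / x] has
   additionality 1, so that in [F / x] every label occurs once.  The two x-edges
   are then opposite sides of a square with labels [x], [y], and every other
   label occurs once.  Deleting the square leaves the four classes of members
   having the same trace on [{x, y}], and these are trees.  Conversely, in a
   semitree the labels occur in this way, which makes shortest paths
   geodesic in the hypercube and gives the count by contracting [x].
   All these conditions are invariant under flips; when the empty set is a
   member, the distance from it is the cardinality, so edges point away. *)

Require Import Defs.
From HB Require Import structures.
From mathcomp Require Import all_boot all_order all_algebra.
From mathcomp Require Import zify.

Set Implicit Arguments.
Unset Strict Implicit.
Unset Printing Implicit Defensive.

(** * Bit flips and symmetric differences *)

Section Families.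
Variable X : finType.
Implicit Types (F : {set {set X}}) (A B C D : {set X}) (x y z : X).

Lemma in_symdiff x A B : (x \in symdiff A B) = (x \in A) (+) (x \in B).
Proof. by rewrite !inE; do 2!case: (_ \in _). Qed.

Lemma in_bitflip y x A : (y \in bitflip x A) = (y == x) (+) (y \in A).
Proof.
rewrite /bitflip; case: ifP => xA; rewrite !inE.
  by have [->|_] := eqVneq y x; rewrite ?xA.
by have [->|_] := eqVneq y x; rewrite ?xA.
Qed.

Lemma setD1_id x A : x \notin A -> A :\ x = A.
Proof. by rewrite -disjoints1 disjoint_sym => /setDidPl. Qed.

Lemma bitflip_setU1 x A : x \notin A -> bitflip x A = x |: A.
Proof. by rewrite /bitflip => /negPf->. Qed.

Lemma bitflipK x : involutive (bitflip x).
Proof. by move=> A; apply/setP=> y; rewrite !in_bitflip addKb. Qed.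

Lemma symdiffK D : involutive (fun A => symdiff A D).
Proof. by move=> A; apply/setP=> x; rewrite !in_symdiff addbK. Qed.

Lemma bitflip_symdiff x A D : bitflip x (symdiff A D) = symdiff (bitflip x A) D.
Proof. by apply/setP=> y; rewrite !(in_symdiff, in_bitflip) addbA. Qed.

Lemma symdiff_flip A B D : symdiff (symdiff A D) (symdiff B D) = symdiff A B.
Proof. by apply/setP=> x; rewrite !in_symdiff addbACA addbb addbF. Qed.

Lemma symdiff_bitflip x A B : x \in symdiff A B ->
  symdiff (bitflip x A) B = symdiff A B :\ x.
Proof.
rewrite in_symdiff => xAB; apply/setP=> y.
rewrite in_setD1 !in_symdiff in_bitflip; have [->|//] := eqVneq y x.
by rewrite -addbA xAB.
Qed.

Lemma card_symdiff_bitflip x A B : x \in symdiff A B ->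
  #|symdiff A B| = #|symdiff (bitflip x A) B|.+1.
Proof. by move=> xAB; rewrite symdiff_bitflip // (cardsD1 x) xAB. Qed.

Lemma card_symdiff_bitflip_leq x A B :
  #|symdiff A B| <= #|symdiff (bitflip x A) B|.+1.
Proof.
have [xAB|xAB] := boolP (x \in symdiff A B); first by rewrite (card_symdiff_bitflip xAB).
suff xAB' : x \in symdiff (bitflip x A) B.
  by rewrite (card_symdiff_bitflip xAB') bitflipK; lia.
by move: xAB; rewrite !in_symdiff in_bitflip eqxx /= addNb.
Qed.

Lemma symdiff_eq0 A B : (#|symdiff A B| == 0) = (A == B).
Proof.
apply/eqP/eqP=> [/cards0_eq AB|->]; last by rewrite /symdiff setDv setU0 cards0.
apply/setP=> x; move/setP/(_ x): AB; rewrite in_symdiff inE.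
by do 2!case: (_ \in _).
Qed.

Lemma bitflipD1 x A B : (x \in A) = (x \notin B) -> A :\ x = B :\ x ->
  A = bitflip x B.
Proof.
move=> xAB /setP AB; apply/setP=> y; have := AB y; rewrite !inE in_bitflip.
by have [->|//] := eqVneq y x; rewrite xAB.
Qed.

(** * Essential elements, edges and contraction *)

Lemma mem_ess F x :
  reflect (exists A B, [/\ A \in F, B \in F & x \in symdiff A B]) (x \in ess F).
Proof.
rewrite inE; apply: (iffP andP) => [[/existsP[A /andP[AF xA]]]|].
  move=> /existsP[B /andP[BF xB]]; exists A, B.
  by rewrite in_symdiff xA (negPf xB).
move=> [A [B [AF BF]]]; rewrite in_symdiff.
case xA: (x \in A); case xB: (x \in B) => // _;
  split; apply/existsP; [exists A|exists B|exists B|exists A];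
  by rewrite ?AF ?BF ?xA ?xB.
Qed.

(** The local form of well-gradedness: from [A] some first step of a hypercube geodesic towards [B]
    stays in the family. No graph is involved, so it is easy to carry through contractions and
    flips. *)
Definition graded F := {in F &, forall A B, A != B ->
  exists2 x, x \in symdiff A B & bitflip x A \in F}.

Definition contract F x : {set {set X}} := [set A :\ x | A in F].

(* An edge is encoded by its lower endpoint. *)
Definition edges F x : {set {set X}} := [set A in F | (x \notin A) && (x |: A \in F)].

Lemma mem_edges F x A : A \in F -> bitflip x A \in F -> A :\ x \in edges F x.
Proof.
rewrite /bitflip inE setD11; case: ifP => [xA ? ->|/negbT xA AF].
  by rewrite setD1K.
by rewrite setD1_id ?AF ?xA.
Qed.

Lemma edgesP F x A : reflect [/\ A \in F, x \notin A & x |: A \in F]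
  (A \in edges F x).
Proof. by rewrite inE; apply: and3P. Qed.

Lemma edges_ess F x A : A \in edges F x -> x \in ess F.
Proof.
case/edgesP=> AF xA xAF; apply/mem_ess; exists A, (x |: A); split=> //.
by rewrite in_symdiff (negPf xA) setU11.
Qed.

(** Deleting [x] is injective on the members containing [x] and on the others. The two images have
    union [contract F x] and intersection [edges F x]. *)
Lemma card_contract F x : #|F| = #|contract F x| + #|edges F x|.
Proof.
pose F1 := F :&: [set A : {set X} | x \in A].
pose F0 := F :\: [set A : {set X} | x \in A].
have -> : contract F x = F0 :|: [set A :\ x | A in F1].
  apply/setP=> A; rewrite inE; apply/imsetP/orP=> [[B BF ->]|[|/imsetP[B]]].
  - have [xB|xB] := boolP (x \in B).
      by right; apply/imsetP; exists B; rewrite // !inE BF.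
    by left; rewrite !inE eqxx /= setD1_id ?xB ?BF.
  - by case/setDP=> AF; rewrite inE => xA; exists A => //; rewrite ?setD1_id.
  - by rewrite !inE => /andP[BF _] ->; exists B.
have -> : edges F x = F0 :&: [set A :\ x | A in F1].
  apply/setP=> A; rewrite !inE.
  apply/idP/idP=> [/and3P[-> xA AF]|/andP[/andP[xA ->]] /imsetP[B]].
    by rewrite xA; apply/imsetP; exists (x |: A); rewrite ?setU1K // !inE AF eqxx.
  by rewrite !inE xA => /andP[BF xB] ->; rewrite setD1K.
rewrite cardsUI card_in_imset 1?addnC ?cardsID //.
move=> A B; rewrite !inE => /andP[_ xA] /andP[_ xB] AB.
by rewrite -(setD1K xA) AB setD1K.
Qed.

Lemma ess_contract F x : ess (contract F x) = ess F :\ x.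
Proof.
apply/setP=> y; rewrite in_setD1; apply/mem_ess/andP.
  move=> [_ [_ [/imsetP[A AF ->] /imsetP[B BF ->]]]].
  rewrite in_symdiff !in_setD1; case: eqP => //= _ yAB; split=> //.
  by apply/mem_ess; exists A, B; split; rewrite ?in_symdiff.
move=> [yx /mem_ess[A [B [AF BF yAB]]]]; exists (A :\ x), (B :\ x).
by split; try exact: imset_f; move: yAB; rewrite !in_symdiff !in_setD1 yx.
Qed.

Lemma bitflipD1_eq x A : bitflip x A :\ x = A :\ x.
Proof. by apply/setP=> y; rewrite !inE in_bitflip; case: eqP. Qed.

Lemma bitflipD1C x y A : y != x -> bitflip y A :\ x = bitflip y (A :\ x).
Proof.
move=> yx; apply/setP=> z; rewrite !(inE, in_bitflip).
by have [->|_] := eqVneq z x; rewrite ?(eq_sym x) ?(negPf yx).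
Qed.

Lemma graded_contract F x : graded F -> graded (contract F x).
Proof.
move=> gF _ _ /imsetP[A AF ->] /imsetP[B BF ->] nAB.
suff [A' [y [A'F AA' yx yAB yF]]] : exists A' y,
    [/\ A' \in F, A' :\ x = A :\ x, y != x, y \in symdiff A' B & bitflip y A' \in F].
  exists y; last by rewrite -AA' -bitflipD1C //; apply: imset_f.
  by rewrite -AA'; move: yAB; rewrite !in_symdiff !in_setD1 yx.
have [|y yAB yF] := gF _ _ AF BF; first by apply: contraNneq nAB => ->.
(* A first step that flips [x] is invisible after contraction; the second step is then used. It
   cannot flip [x] back, since it also moves towards [B]. *)
have [E|yx] := eqVneq y x; last by exists A, y.
move: yAB yF; rewrite {y}E => xAB xF.
have nA'B : bitflip x A != B by apply: contraNneq nAB => <-; rewrite bitflipD1_eq.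
have [y yAB yF] := gF _ _ xF BF nA'B.
exists (bitflip x A), y; split=> //; first by rewrite bitflipD1_eq.
by move: yAB; rewrite symdiff_bitflip // in_setD1 => /andP[].
Qed.

(** Greedy steps from [A] to [B] flip only elements of the symmetric difference, each once, so [y]
    is flipped at some step; [C] is the lower end of that step. *)
Lemma edge_between F A B y : graded F -> A \in F -> B \in F ->
  y \in symdiff A B ->
  exists2 C, C \in edges F y &
    forall x, x \notin symdiff A B -> (x \in C) = (x \in A).
Proof.
move=> gF; have [n] := ubnP #|symdiff A B|.
elim: n A => // n IH A le_n AF BF yAB.
have nAB : A != B.
  by rewrite -symdiff_eq0 -lt0n; apply/card_gt0P; exists y.
have [z zAB zF] := gF _ _ AF BF nAB.
have [E|zy] := eqVneq z y.
  exists (A :\ y); first by rewrite mem_edges // -E.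
  move=> x xAB; rewrite in_setD1; have [E'|//] := eqVneq x y.
  by rewrite E' yAB in xAB.
have [||||C yC CP] := IH (bitflip z A) => //.
- by rewrite -ltnS -card_symdiff_bitflip.
- by rewrite symdiff_bitflip // in_setD1 eq_sym zy.
exists C => // x xAB; have xz : x != z by apply: contraNneq xAB => ->.
rewrite CP ?in_bitflip ?(negPf xz) // symdiff_bitflip //.
by rewrite in_setD1 xz.
Qed.

Lemma edges_gt0 F x : graded F -> x \in ess F -> 0 < #|edges F x|.
Proof.
move=> gF /mem_ess[A [B [AF BF xAB]]]; apply/card_gt0P.
by have [C xC _] := edge_between gF AF BF xAB; exists C.
Qed.

(** * Counting by contraction, and squares *)

Lemma contract_eq0 F x : (contract F x == set0) = (F == set0).
Proof. by rewrite imset_eq0. Qed.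

Lemma card_ess_contract F x : x \in ess F ->
  #|ess F| = #|ess (contract F x)|.+1.
Proof. by move=> xF; rewrite ess_contract (cardsD1 x) xF. Qed.

(** Contracting an essential element removes one essential element and at least one member, by
    [edges_gt0]; at the end a nonempty family remains. *)
Lemma card_ess_ltn F : graded F -> F != set0 -> #|ess F| < #|F|.
Proof.
have [n] := ubnP #|ess F|; elim: n F => // n IH F le_n gF F0.
have [->|[x xF]] := set_0Vmem (ess F); first by rewrite cards0 card_gt0.
have := edges_gt0 gF xF; have := card_contract F x.
have := IH (contract F x); rewrite contract_eq0.
move: le_n; rewrite (card_ess_contract xF) => le_n.
by move=> /(_ le_n (graded_contract gF) F0) *; lia.
Qed.

Lemma card_edges_leq F x : graded F -> x \in ess F ->
  #|edges F x| + #|ess F| <= #|F|.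
Proof.
move=> gF xF; have F0 : F != set0.
  by case/mem_ess: xF => A [_ [AF _ _]]; apply/set0Pn; exists A.
have := @card_ess_ltn (contract F x) (graded_contract gF).
rewrite contract_eq0 => /(_ F0); have := card_contract F x.
by rewrite (card_ess_contract xF) => *; lia.
Qed.

(** Contraction creates no new edges: lifts of the two ends differ in [z] and possibly in [x], and
    the [z]-edge of [F] between these lifts has the required image. *)
Lemma edges_contract F x z : graded F ->
  edges (contract F x) z \subset [set C :\ x | C in edges F z].
Proof.
move=> gF; apply/subsetP=> D /edgesP[/imsetP[A AF ->{D}] zA /imsetP[B BF zAB]].
have zx : z != x.
  by apply: contraTneq (setU11 z (A :\ x)) => E; rewrite zAB E setD11.
have zAB' : z \in symdiff A B.
  move/setP/(_ z): zAB zA; rewrite in_setU1 !in_setD1 eqxx zx /= => /esym zB zA.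
  by rewrite in_symdiff zB (negPf zA).
have [C zC CP] := edge_between gF AF BF zAB'.
apply/imsetP; exists C => //; apply/setP=> y; rewrite !inE.
have [//|yx] := eqVneq y x; have [->|yz] := eqVneq y z.
  by case/edgesP: zC => _ /negPf-> _; move: zA; rewrite !inE zx => /negPf.
rewrite CP // in_symdiff; move/setP/(_ y): zAB.
by rewrite !inE (negPf yz) (negPf yx) /= => ->; rewrite addbb.
Qed.

Lemma contract_edges F x z C : z != x -> C \in edges F z ->
  C :\ x \in edges (contract F x) z.
Proof.
move=> zx /edgesP[CF zC zCF]; apply/edgesP; split.
- exact: imset_f.
- by rewrite inE (negPf zC) andbF.
- apply/imsetP; exists (z |: C) => //; apply/setP=> y; rewrite !inE.
  by have [->|] := eqVneq y z; rewrite ?zx.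
Qed.

Lemma card_leq_ess F : graded F -> (forall z, #|edges F z| <= 1) ->
  #|F| <= #|ess F|.+1.
Proof.
have [n] := ubnP #|ess F|; elim: n F => // n IH F le_n gF F1.
(* Two distinct members would differ in an essential element, so without one there is at most one
   member. *)
have [E0|[x xF]] := set_0Vmem (ess F).
  rewrite E0 cards0; apply/card_le1P=> A AF B; rewrite inE.
  apply/idP/eqP=> [BF|-> //]; apply/eqP; apply: contraTT isT => nBA.
  have [x xBA _] := gF _ _ BF AF nBA.
  suff : x \in ess F by rewrite E0 inE.
  by apply/mem_ess; exists B, A.
have := IH (contract F x); move: le_n; rewrite (card_ess_contract xF) => le_n.
move=> /(_ le_n (graded_contract gF)) IHx.
rewrite (card_contract F x).
have/IHx : forall z, #|edges (contract F x) z| <= 1; last by have := F1 x => *; lia.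
move=> z; apply: leq_trans (subset_leq_card (edges_contract x z gF)) _.
exact: leq_trans (leq_imset_card _ _) (F1 z).
Qed.

(** [C] is the bottom corner. Since edges are recorded by their lower ends, the two equations list
    opposite sides of the square and exclude all further edges with these labels. *)
Definition square F x y C := [/\ x != y, edges F x = [set C; y |: C],
  edges F y = [set C; x |: C] &
  forall z, z != x -> z != y -> #|edges F z| <= 1].

Lemma squareN F x y C : square F x y C -> x \notin C /\ y \notin C.
Proof.
case=> _ Ex Ey _; have := set21 C (y |: C); have := set21 C (x |: C).
by rewrite -Ex -Ey => /edgesP[_ -> _] /edgesP[_ -> _].
Qed.

(** Contracting [x] merges the two [y]-edges, so every label of the contraction occurs at most once
    and its additionality is 1; the two [x]-edges raise this to 2. *)
Lemma card_square F x y C : graded F -> square F x y C -> #|F| = #|ess F|.+2.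
Proof.
move=> gF sq; have [xC yC] := squareN sq; case: sq => xy Ex Ey Ez.
have xF : x \in ess F by apply: (@edges_ess _ _ C); rewrite Ex set21.
have Ex2 : #|edges F x| = 2.
  by rewrite Ex cards2; case: eqP => // CC; rewrite CC setU11 in yC.
have := card_contract F x; rewrite Ex2 (card_ess_contract xF).
suff : #|contract F x| <= #|ess (contract F x)|.+1.
  have := card_ess_ltn (graded_contract gF (x:=x)); rewrite contract_eq0.
  have F0 : F != set0.
    by case/mem_ess: xF => A [_ [AF _ _]]; apply/set0Pn; exists A.
  by move/(_ F0) => *; lia.
apply: (card_leq_ess (graded_contract gF)) => z.
have sub := edges_contract x z gF.
have [->|zx] := eqVneq z x.
  rewrite (_ : edges _ _ = set0) ?cards0 //; apply/setP=> A; rewrite in_set0.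
  apply/negP=> /edgesP[_ _ /imsetP[B _] /setP/(_ x)].
  by rewrite !inE eqxx.
apply: leq_trans (subset_leq_card sub) _.
have [->|zy] := eqVneq z y; last by apply: leq_trans (leq_imset_card _ _) (Ez _ _ _).
have -> : [set C' :\ x | C' in edges F y] = [set C :\ x]; last by rewrite cards1.
rewrite Ey imsetU1 imset_set1 setU1K // setD1_id ?setUid //.
Qed.

Lemma eq_or_bitflip x A B : A :\ x = B :\ x -> A = B \/ A = bitflip x B.
Proof.
move=> AB; have [E|E] := eqVneq (x \in A) (x \in B).
  left; apply/setP=> y; move/setP/(_ y): AB; rewrite !inE.
  by have [->|] := eqVneq y x; rewrite ?E.
by right; apply: bitflipD1 => //; move: E; do 2!case: (_ \in _).
Qed.

Lemma square_exists F : graded F -> #|F| = #|ess F|.+2 ->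
  exists x y C, square F x y C.
Proof.
move=> gF cF.
(* If no label were repeated, the additionality would be at most 1. *)
have [x x2] : exists x, 1 < #|edges F x|.
  apply/existsP; rewrite -[X in is_true X]negbK negb_exists; apply/negP=> /forallP E1.
  suff : #|F| <= #|ess F|.+1 by rewrite cF ltnn.
  by apply: card_leq_ess => // z; rewrite leqNgt.
have xF : x \in ess F.
  by case/card_gt1P: (x2) => A [_ [xA _ _]]; apply: edges_ess xA.
have Ex2 : #|edges F x| = 2.
  by apply/eqP; rewrite eqn_leq x2 andbT; have := card_edges_leq gF xF => *; lia.
(* The contraction by [x] has additionality 1, so none of its labels is repeated: two [z]-edges of
   [F] can differ only in [x]. *)
have E1 z : z != x -> {in edges F z &, forall C C', C :\ x = C' :\ x}.
  move=> zx C C' zC zC'; apply/eqP; apply: contraTT isT => nCC'.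
  have zCx := contract_edges zx zC.
  have := card_edges_leq (graded_contract gF (x:=x)) (edges_ess zCx).
  have := card_ess_contract xF; have := card_contract F x.
  suff : 1 < #|edges (contract F x) z| by move=> *; lia.
  by apply/card_gt1P; exists (C :\ x), (C' :\ x); split; rewrite // contract_edges.
case/card_gt1P: x2 => A [B [/edgesP[AF xA xAF] /edgesP[BF xB xBF] nAB]].
have [y yAB _] := gF _ _ AF BF nAB.
have yx : y != x.
  by apply: contraTneq yAB => ->; rewrite in_symdiff (negPf xA) (negPf xB).
(* One [y]-edge is found between the lower ends of the two [x]-edges and one between their upper
   ends; by [E1] they agree up to [x], so they bound a square. *)
have [C1 yC1 C1P] := edge_between gF AF BF yAB.
have yAB2 : y \in symdiff (x |: A) (x |: B).
  by move: yAB; rewrite !in_symdiff !inE (negPf yx).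
have [C2 yC2 C2P] := edge_between gF xAF xBF yAB2.
have xC1 : x \notin C1 by rewrite C1P // in_symdiff (negPf xA) (negPf xB).
have xC2 : x \in C2 by rewrite C2P ?in_symdiff ?setU11.
have EC2 : C2 = x |: C1 by rewrite -(setD1K xC2) (E1 y yx _ _ yC2 yC1) setD1_id.
rewrite {}EC2 in yC2 {xC2 C2P}.
have [C1F yNC1 yC1F] := edgesP _ _ _ yC1; have [xC1F _ yxC1F] := edgesP _ _ _ yC2.
have Ex : edges F x = [set C1; y |: C1].
  apply/esym/eqP; rewrite eqEcard Ex2 cards2.
  rewrite (_ : C1 != y |: C1); last by apply: contraNneq yNC1 => ->; apply: setU11.
  rewrite andbT; apply/subsetP=> C; rewrite !inE => /orP[] /eqP->.
    by rewrite C1F xC1.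
  by rewrite yC1F !inE negb_or eq_sym yx xC1 setUCA.
have Ey : edges F y = [set C1; x |: C1].
  apply/setP=> C; rewrite in_set2; apply/idP/orP=> [yC|[]/eqP-> //].
  have := E1 y yx _ _ yC yC1; case/eq_or_bitflip=> ->; rewrite ?eqxx; first by left.
  by right; rewrite bitflip_setU1.
exists x, y, C1; split; rewrite ?(eq_sym x) // => z zx zy.
rewrite leqNgt; apply/negP=> /card_gt1P[D1 [D2 [zD1 zD2 nD]]].
(* By [E1] two [z]-edges would be opposite sides of a square with [x]. Then [D] and [z |: D] would
   both be [x]-edges, which forces [z] to be [y]. *)
have {zD1 zD2 nD} [D xD [zD zxD]] : exists2 D : {set X}, x \notin D &
    D \in edges F z /\ x |: D \in edges F z.
  have ED := E1 z zx _ _ zD1 zD2.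
  case: (eq_or_bitflip ED) nD zD1 => [->|->]; rewrite ?eqxx // => _.
  rewrite /bitflip; case: ifP => [xD2|/negbT xD2] zD1.
    by exists (D2 :\ x); rewrite ?setD11 ?setD1K.
  by exists D2.
have [DF zND zDF] := edgesP _ _ _ zD; have [xDF _ zxDF] := edgesP _ _ _ zxD.
have : D \in edges F x by apply/edgesP.
have : z |: D \in edges F x.
  by apply/edgesP; rewrite setUCA !inE negb_or eq_sym zx.
rewrite Ex !in_set2 => /orP zDC /orP DC; have := setU11 z D.
case: zDC => /eqP->; case: DC zND => /eqP->.
- by move=> /negPf->.
- by rewrite in_setU1 negb_or => /andP[_ /negPf->].
- by rewrite in_setU1 (negPf zy) /= => /negPf->.
- by move=> /negPf->.
Qed.
End Families.

(** * Walks and distances in the one-inclusion graph *)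

Section OneInclusionGraph.
Variables (X : finType) (F : {set {set X}}).
Implicit Types (A B C D : {set X}) (x y z k : X) (u v w : vertex F).
Local Notation G := (one_inclusion_graph F).
Local Notation arc := (Defs.arc G).

Lemma vertex_of A : A \in F -> exists u : vertex F, val u = A.
Proof. by move=> AF; exists (exist _ A AF). Qed.

Lemma arcE u v x : arc u v = Some x <-> x \notin val u /\ val v = x |: val u.
Proof. exact: oig_arcP. Qed.

Lemma arc_edges u v x : arc u v = Some x -> val u \in edges F x.
Proof. by case/arcE=> xu vE; apply/edgesP; rewrite -vE; split=> //; apply: valP. Qed.

Lemma adjP u v : reflect (exists x, val v = bitflip x (val u)) (adj G u v).
Proof.
apply: (iffP orP) => [[]|[x vE]].
- case E: (arc u v) => [x|] // _; case/arcE: E => xu ->.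
  by exists x; rewrite bitflip_setU1.
- case E: (arc v u) => [x|] // _; case/arcE: E => xv ->.
  by exists x; rewrite -bitflip_setU1 // bitflipK.
have [xu|xu] := boolP (x \in val u); [right|left].
  suff -> : arc v u = Some x by [].
  apply/arcE; rewrite vE in_bitflip eqxx xu; split=> //.
  by rewrite /bitflip xu setD1K.
by suff -> : arc u v = Some x; [|apply/arcE; rewrite vE bitflip_setU1].
Qed.

Lemma adj_sym : symmetric (adj G).
Proof. by move=> u v; exact: orbC. Qed.

Lemma arc_card u v : adj G u v -> arc u v <-> #|val u| < #|val v|.
Proof.
move=> uv; split.
  case E: (arc u v) => [x|] // _; case/arcE: E => xu ->.
  by rewrite cardsU1 xu.
case/orP: uv => // ; case E: (arc v u) => [x|] // _; case/arcE: E => xv ->.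
by rewrite cardsU1 xv => /ltnW; rewrite ltnn.
Qed.

Lemma path_card_symdiff p u :
  path (adj G) u p -> #|symdiff (val u) (val (last u p))| <= size p.
Proof.
elim: p u => [u _|w p IH u /=/andP[/adjP[x wE] /IH]].
  by rewrite leqn0 symdiff_eq0.
by rewrite {1}wE => le_p; apply: leq_trans (card_symdiff_bitflip_leq x _ _) _.
Qed.

Lemma graded_walk u v : graded F -> walk G #|symdiff (val u) (val v)| u v.
Proof.
move=> gF; have [n] := ubnP #|symdiff (val u) (val v)|.
elim: n u => // n IH u le_n; have [uv|nuv] := eqVneq (val u) (val v).
  have /eqP-> : #|symdiff (val u) (val v)| == 0 by rewrite symdiff_eq0 uv.
  by apply/walkP; exists [::]; rewrite (val_inj uv).
have [x xuv xF] := gF _ _ (valP u) (valP v) nuv.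
have [w wE] := vertex_of xF; have uvE := card_symdiff_bitflip xuv.
rewrite -wE in uvE; have [|p [sp pp lp]] := walkP _ _ _ _ (IH w _).
  by rewrite -ltnS -uvE.
rewrite uvE; apply/walkP; exists (w :: p); rewrite /= sp pp lp andbT.
by split=> //; apply/adjP; exists x.
Qed.

Lemma well_gradedP : well_graded F <-> graded F.
Proof.
split=> [wF A B AF BF|gF u v].
  have [u <-] := vertex_of AF; have [v <-] := vertex_of BF => nuv.
  have /dist_Some[/walkP[[|w p] [sp /= pp lp]] _] := wF u v.
    by move: nuv; rewrite -symdiff_eq0 -sp.
  case/andP: pp => /adjP[x wE] /path_card_symdiff; rewrite lp => le_p.
  (* If the first step of a shortest walk flipped an element outside the symmetric difference, it
     would move away from [v], and the rest of the walk would be too short. *)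
  exists x; last by rewrite -wE; apply: valP.
  apply: contraTT le_p; rewrite in_symdiff -ltnNge => xuv.
  have xwv : x \in symdiff (val w) (val v).
    by rewrite in_symdiff wE in_bitflip eqxx addNb.
  by rewrite (card_symdiff_bitflip xwv) wE bitflipK -sp /=; lia.
apply/dist_Some; split; first exact: graded_walk.
by move=> m /walkP[p [<- /path_card_symdiff + <-]].
Qed.

(** * Squares and semitrees *)

Lemma C4_edge_vals a1 a2 a3 a4 u v :
  C4_edge a1 a2 a3 a4 u v ->
  [\/ (u = a1 /\ v = a2) \/ (u = a2 /\ v = a1),
      (u = a2 /\ v = a3) \/ (u = a3 /\ v = a2),
      (u = a3 /\ v = a4) \/ (u = a4 /\ v = a3) |
      (u = a4 /\ v = a1) \/ (u = a1 /\ v = a4)].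
Proof.
have set2E (a b : vertex F) : [set u; v] = [set a; b] ->
    (u = a /\ v = b) \/ (u = b /\ v = a).
  move=> E; have := set21 u v; have := set22 u v.
  have := set21 a b; have := set22 a b.
  rewrite E -{1 2}E !in_set2.
  by do 4![case/orP=> /eqP ?]; subst; auto.
by rewrite /C4_edge !inE => /or4P[]/eqP/set2E ?;
  [constructor 1|constructor 2|constructor 3|constructor 4].
Qed.

Lemma arc_inj k u v u' v' : #|edges F k| <= 1 ->
  arc u v = Some k -> arc u' v' = Some k -> u = u' /\ v = v'.
Proof.
move=> /card_le1P Ek uv uv'; have uu' : u = u'.
  apply: val_inj; move/(_ _ (arc_edges uv) (val u')): Ek.
  by rewrite (arc_edges uv') inE eq_sym => /esym/eqP.
split=> //; apply: val_inj; case/arcE: uv => _ ->; case/arcE: uv' => _ ->.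
by rewrite uu'.
Qed.

Lemma adj_arc k u v : adj G u v -> k \notin val u -> k \in val v ->
  arc u v = Some k.
Proof.
case/adjP=> j vE ku; rewrite vE in_bitflip (negPf ku) addbF => /eqP kj.
by apply/arcE; rewrite vE -kj bitflip_setU1.
Qed.

Lemma adj_inj k u v s t : #|edges F k| <= 1 ->
  adj G u v -> (k \in val u) != (k \in val v) ->
  adj G s t -> (k \in val s) != (k \in val t) ->
  (s = u /\ t = v) \/ (s = v /\ t = u).
Proof.
move=> Ek uv kuv st kst.
have oriented w w' : adj G w w' -> (k \in val w) != (k \in val w') ->
    arc w w' = Some k \/ arc w' w = Some k.
  move=> ww'; case kw: (k \in val w); case kw': (k \in val w') => // _.
    by right; apply: adj_arc; rewrite ?kw' // adj_sym.
  by left; apply: adj_arc; rewrite ?kw.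
case: (oriented _ _ st kst) => st'; case: (oriented _ _ uv kuv) => uv';
  by have [-> ->] := arc_inj Ek st' uv'; auto.
Qed.

(* Two vertices with the same trace on [{x, y}] are joined without using the
   labels x and y; every other label occurs once, and the label of an edge of a
   cycle would have to occur twice on it. *)
Lemma tree_on_trace x y (a : vertex F) : graded F ->
  (forall z, z != x -> z != y -> #|edges F z| <= 1) ->
  tree_on G [set u : vertex F |
    (x \in val u, y \in val u) == (x \in val a, y \in val a)].
Proof.
move=> gF Ez; pose f u := (x \in val u, y \in val u).
rewrite -[[set u | _]]/[set u | f u == f a]; set T := [set u | _].
split=> [u v uT vT|p sub_p sz_p].
  have [n] := ubnP #|symdiff (val u) (val v)|; elim: n u uT => // n IH u uT le_n.
  have [uv|nuv] := eqVneq (val u) (val v); first by rewrite (val_inj uv).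
  have [k kuv kF] := gF _ _ (valP u) (valP v) nuv; have [w wE] := vertex_of kF.
  have [fx fy] : f u = f v by move: uT vT; rewrite !inE => /eqP-> /eqP->.
  have kx : k != x by apply: contraTneq kuv => ->; rewrite in_symdiff fx addbb.
  have ky : k != y by apply: contraTneq kuv => ->; rewrite in_symdiff fy addbb.
  have wT : w \in T.
    move: uT; rewrite !inE /f wE !in_bitflip.
    by rewrite ![_ == k]eq_sym (negPf kx) (negPf ky).
  apply: connect_trans (IH w wT _); last first.
    by rewrite wE -ltnS -card_symdiff_bitflip.
  by apply: connect1; rewrite /= uT wT; apply/adjP; exists k.
case: p sub_p sz_p => [|u [|v [|w p]]] // sub_p _ /andP[/= /and3P[uv vw]].
rewrite rcons_path => /andP[pw lu] /andP[nu /andP[nv _]].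
have [k vE] := adjP _ _ uv.
have kuv : (k \in val u) != (k \in val v).
  by rewrite vE in_bitflip eqxx; case: (_ \in _).
have [fx fy] : f u = f v.
  have := sub_p u; have := sub_p v; rewrite !inE !eqxx orbT /=.
  by move=> /(_ isT)/eqP-> /(_ isT)/eqP->.
have kx : k != x by apply: contraNneq kuv => ->; rewrite fx.
have ky : k != y by apply: contraNneq kuv => ->; rewrite fy.
(* Only the edge between [u] and [v] changes membership of [k]. The rest of the cycle avoids this
   edge, so it could never return to the side of [u]. *)
have kadj s t := @adj_inj k u v s t (Ez k kx ky) uv kuv.
have kw : (k \in val v) = (k \in val w).
  apply/eqP; apply: contraT => nwv.
  case: (kadj _ _ vw nwv) => [[E _]|[_ E]].
    by rewrite -E !inE eqxx in nu.
  by rewrite -E !inE eqxx orbT in nu.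
have klast : (k \in val w) = (k \in val (last w p)).
  have : all (fun s => s != v) (w :: p).
    by apply/allP=> s sp; apply: contraNneq nv => <-.
  have : all (fun s => s != u) (w :: p).
    by apply/allP=> s sp; apply: contraNneq nu => <-; rewrite inE sp orbT.
  elim: p w pw {vw lu sub_p nu nv kw} => //= t p IH w /andP[wt pt].
  move=> /andP[wu tu] /andP[wv tv]; rewrite -IH //.
  apply/eqP; apply: contraT => nwt.
  by case: (kadj _ _ wt nwt) => [[E _]|[E _]]; rewrite E eqxx in wu wv.
have nlu : (k \in val (last w p)) != (k \in val u) by rewrite -klast -kw eq_sym.
case: (kadj _ _ lu nlu) => [[E _]|[E _]].
  by move: nu; rewrite -E inE mem_last orbT.
by move: nv; rewrite -E mem_last.
Qed.

(** The corners realise the four traces on [{x, y}], so the fibres of the trace serve as the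
    attached trees; an edge with any other label stays within a fibre. *)
Lemma square_semitree x y C : graded F -> square F x y C -> semitree G.
Proof.
move=> gF sq; have [xC yC] := squareN sq; have [xy Ex Ey Ez] := sq.
have [CF _ xCF] : [/\ C \in F, x \notin C & x |: C \in F].
  by apply/edgesP; rewrite Ex set21.
have [yCF _ xyCF] : [/\ y |: C \in F, x \notin y |: C & x |: (y |: C) \in F].
  by apply/edgesP; rewrite Ex set22.
have [a1 E1] := vertex_of CF; have [a2 E2] := vertex_of xCF.
have [a3 E3] := vertex_of xyCF; have [a4 E4] := vertex_of yCF.
have yx : (y == x) = false by rewrite eq_sym (negPf xy).
pose f u := (x \in val u, y \in val u).
have f1 : f a1 = (false, false) by rewrite /f E1 (negPf xC) (negPf yC).
have f2 : f a2 = (true, false) by rewrite /f E2 !in_setU1 eqxx yx (negPf yC).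
have f3 : f a3 = (true, true) by rewrite /f E3 !in_setU1 !eqxx orbT.
have f4 : f a4 = (false, true).
  by rewrite /f E4 !in_setU1 eqxx (negPf xy) (negPf xC).
have a12 : arc a1 a2 = Some x by apply/arcE; rewrite E1 E2.
have a43 : arc a4 a3 = Some x.
  by apply/arcE; rewrite E4 E3 !inE negb_or xy.
have a23 : arc a2 a3 = Some y.
  by apply/arcE; rewrite E2 E3 setUCA !inE negb_or yx.
have a14 : arc a1 a4 = Some y by apply/arcE; rewrite E1 E4.
have inner u v k : arc u v = Some k -> (k == x) || (k == y) ->
    C4_edge a1 a2 a3 a4 u v.
  move=> uv kxy; have := arc_edges uv; case/arcE: uv => _ vE.
  rewrite /C4_edge !in_cons; case/orP: kxy vE => /eqP-> vE.
    rewrite Ex in_set2 => /orP[]/eqP uE.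
      have -> : u = a1 by apply: val_inj; rewrite uE.
      by have -> : v = a2; [apply: val_inj; rewrite vE uE|rewrite eqxx].
    have -> : u = a4 by apply: val_inj; rewrite uE.
    have -> : v = a3 by apply: val_inj; rewrite vE uE.
    by rewrite [[set a4; a3]]setUC eqxx !orbT.
  rewrite Ey in_set2 => /orP[]/eqP uE.
    have -> : u = a1 by apply: val_inj; rewrite uE.
    have -> : v = a4 by apply: val_inj; rewrite vE uE.
    by rewrite [[set a1; a4]]setUC eqxx !orbT.
  have -> : u = a2 by apply: val_inj; rewrite uE.
  have -> : v = a3 by apply: val_inj; rewrite vE uE setUCA.
  by rewrite eqxx !orbT.
pose T a := [set u | f u == f a].
have outerT u v k : arc u v = Some k -> k != x -> k != y -> f u = f v.
  by case/arcE=> _ vE; rewrite /f vE !in_setU1 ![_ == k]eq_sym => /negPf-> /negPf->.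
exists a1, a2, a3, a4, x, y, T; split.
- split=> //; try by left.
  by apply: (@map_uniq _ _ f); rewrite /= f1 f2 f3 f4.
- by move=> a _; split; [rewrite inE|apply: tree_on_trace].
- split=> [a b|v].
    move=> ac bc nab; apply/pred0P=> u /=; rewrite !inE; apply/negP.
    case/andP=> /eqP-> ; move: ac bc nab; rewrite !inE.
    by case/or4P=> /eqP->; case/or4P=> /eqP->; rewrite ?eqxx ?f1 ?f2 ?f3 ?f4.
  have [a ac fva] : exists2 a, a \in [:: a1; a2; a3; a4] & f v = f a.
    by case: (f v) => [[] []]; [exists a3|exists a2|exists a4|exists a1];
      rewrite ?f1 ?f2 ?f3 ?f4 // !inE eqxx ?orbT.
  by exists a; rewrite // inE fva.
- move=> u v; case E: (arc u v) => [k|] // _.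
  have [kxy|] := boolP ((k == x) || (k == y)); first by left; apply: inner E kxy.
  rewrite negb_or => /andP[kx ky]; right.
  have [a ac fua] : exists2 a, a \in [:: a1; a2; a3; a4] & f u = f a.
    by case: (f u) => [[] []]; [exists a3|exists a2|exists a4|exists a1];
      rewrite ?f1 ?f2 ?f3 ?f4 // !inE eqxx ?orbT.
  by exists a; rewrite // !inE -(outerT _ _ _ E kx ky) fua eqxx.
have outer_xy u v k : arc u v = Some k /\ ~~ C4_edge a1 a2 a3 a4 u v ->
    k != x /\ k != y.
  case=> uv nC; apply/andP; rewrite -negb_or; apply: contra nC.
  exact: inner uv.
split=> [u v k /outer_xy //|u v u' v' k uvk [uv' _]].
by have [kx ky] := outer_xy _ _ _ uvk; apply: arc_inj uv'; [apply: Ez|case: uvk].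
Qed.

Lemma square_of_C4 a1 a2 a3 a4 x y : x != y ->
  arc a1 a2 = Some x -> arc a4 a3 = Some x ->
  arc a2 a3 = Some y -> arc a1 a4 = Some y ->
  (forall u v k, arc u v = Some k -> (k == x) || (k == y) ->
    C4_edge a1 a2 a3 a4 u v) ->
  (forall z, z != x -> z != y -> #|edges F z| <= 1) ->
  square F x y (val a1).
Proof.
move=> xy a12 a43 a23 a14 inner Ez.
have arcF (u v : vertex F) k : arc u v = Some k -> arc v u = None.
  by move=> uv; apply: arc_asym; rewrite uv.
have yx : (y == x) = false by rewrite eq_sym (negPf xy).
have arc_of A k : A \in edges F k ->
    exists u v : vertex F, val u = A /\ arc u v = Some k.
  case/edgesP=> AF kA kAF; have [u uE] := vertex_of AF; have [v vE] := vertex_of kAF.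
  by exists u, v; split=> //; apply/arcE; rewrite uE vE.
have E2 : val a2 = x |: val a1 by case/arcE: a12.
have E4 : val a4 = y |: val a1 by case/arcE: a14.
split=> //; apply/setP=> A; rewrite in_set2; apply/idP/orP.
- case/arc_of=> u [v [<- uv]]; have := inner _ _ _ uv; rewrite eqxx.
  move/(_ isT)/C4_edge_vals; rewrite -E4.
  by case=> [[]|[]|[]|[]] [uE vE]; move: uv; rewrite uE vE ?a23 ?a14
    ?(arcF _ _ _ a12) ?(arcF _ _ _ a43) ?(arcF _ _ _ a14) ?(arcF _ _ _ a23) //;
    try (by case=> /eqP; rewrite ?yx ?(negPf xy)); auto.
- by rewrite -E4; case=> /eqP->; [apply: arc_edges a12|apply: arc_edges a43].
- case/arc_of=> u [v [<- uv]]; have := inner _ _ _ uv; rewrite eqxx orbT.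
  move/(_ isT)/C4_edge_vals; rewrite -E2.
  by case=> [[]|[]|[]|[]] [uE vE]; move: uv; rewrite uE vE ?a12 ?a43
    ?(arcF _ _ _ a12) ?(arcF _ _ _ a43) ?(arcF _ _ _ a14) ?(arcF _ _ _ a23) //;
    try (by case=> /eqP; rewrite ?yx ?(negPf xy)); auto.
by rewrite -E2; case=> /eqP->; [apply: arc_edges a14|apply: arc_edges a23].
Qed.

(** With [C4_edge_swap14], these reflections move the bottom corner of the cycle to the first
    position, as [square_of_C4] expects. *)
Lemma C4_edge_swap12 a1 a2 a3 a4 u v :
  C4_edge a1 a2 a3 a4 u v = C4_edge a2 a1 a4 a3 u v.
Proof.
rewrite /C4_edge !inE [[set a2; a1]]setUC [[set a1; a4]]setUC.
by rewrite [[set a4; a3]]setUC [[set a3; a2]]setUC; do 4![case: (_ == _)].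
Qed.

Lemma C4_edge_swap14 a1 a2 a3 a4 u v :
  C4_edge a1 a2 a3 a4 u v = C4_edge a4 a3 a2 a1 u v.
Proof.
rewrite /C4_edge !inE [[set a4; a3]]setUC [[set a3; a2]]setUC.
by rewrite [[set a2; a1]]setUC [[set a1; a4]]setUC; do 4![case: (_ == _)].
Qed.

Lemma semitree_square : semitree G -> exists x y C, square F x y C.
Proof.
move=> [a1 [a2 [a3 [a4 [x [y [T [[_ px py xy] _ _ _ [outerN outerU]]]]]]]]].
exists x, y.
have inner u v k : arc u v = Some k -> (k == x) || (k == y) ->
    C4_edge a1 a2 a3 a4 u v.
  move=> uv; apply: contraTT => nC; rewrite negb_or; apply/andP.
  exact: (outerN u v k).
have C4k u v k : arc u v = Some k -> C4_edge a1 a2 a3 a4 u v -> (k == x) || (k == y).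
  move=> uv /C4_edge_vals C4uv.
  have arcF (s t : vertex F) j : arc s t = Some j -> arc t s = None.
    by move=> st; apply: arc_asym; rewrite st.
  case: C4uv => [[]|[]|[]|[]] [uE vE]; move: uv; rewrite uE vE;
    case: px => [][p1 p2]; case: py => [][q1 q2];
    rewrite ?(arcF _ _ _ p1) ?(arcF _ _ _ p2) ?(arcF _ _ _ q1) ?(arcF _ _ _ q2)
      ?p1 ?p2 ?q1 ?q2 // => -[<-]; by rewrite eqxx ?orbT.
have Ez z : z != x -> z != y -> #|edges F z| <= 1.
  move=> zx zy; rewrite leqNgt; apply/negP=> /card_gt1P[A [B [zA zB /eqP[]]]].
  case/edgesP: zA => AF zA zAF; case/edgesP: zB => BF zB zBF.
  have [u uE] := vertex_of AF; have [u' u'E] := vertex_of zAF.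
  have [v vE] := vertex_of BF; have [v' v'E] := vertex_of zBF.
  have uu' : arc u u' = Some z by apply/arcE; rewrite uE u'E.
  have vv' : arc v v' = Some z by apply/arcE; rewrite vE v'E.
  have nzxy : ~~ ((z == x) || (z == y)) by rewrite negb_or zx.
  have [||uv _] := outerU u u' v v' z.
  - by split=> //; apply: contra nzxy; apply: C4k.
  - by split=> //; apply: contra nzxy; apply: C4k.
  by rewrite -uE -vE uv.
(* The directions of the two pairs of parallel edges determine which corner is the bottom one. *)
case: px => [][p1 p2]; case: py => [][q1 q2].
- by exists (val a1); apply: (@square_of_C4 a1 a2 a3 a4).
- exists (val a4); apply: (@square_of_C4 a4 a3 a2 a1) => // u v k uv.
  by rewrite -C4_edge_swap14; apply: inner.
- exists (val a2); apply: (@square_of_C4 a2 a1 a4 a3) => // u v k uv.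
  by rewrite -C4_edge_swap12; apply: inner.
- exists (val a3); apply: (@square_of_C4 a3 a4 a1 a2) => // u v k uv.
  by rewrite -C4_edge_swap12 -C4_edge_swap14; apply: inner.
Qed.

Lemma semitree_connected : semitree G -> forall u v, connect (adj G) u v.
Proof.
move=> [a1 [a2 [a3 [a4 [x [y [T [[_ px py _] treeT [_ coverT] _ _]]]]]]]].
have csym := sym_connect_sym adj_sym.
have arc_adj u v k : arc u v = Some k -> connect (adj G) u v /\ connect (adj G) v u.
  by move=> uv; rewrite csym; split; apply: connect1; apply/orP; rewrite uv; auto.
have c12 : connect (adj G) a1 a2 by case: px => [][/arc_adj[]].
have c23 : connect (adj G) a2 a3 by case: py => [][/arc_adj[]].
have c14 : connect (adj G) a1 a4 by case: py => [][_ /arc_adj[]].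
suff c1 u : connect (adj G) a1 u.
  by move=> u v; apply: connect_trans (c1 v); rewrite csym.
have [a ac uT] := coverT u; have [aT [cT _]] := treeT a ac.
have c1a : connect (adj G) a1 a.
  move: ac; rewrite !inE => /or4P[]/eqP-> //.
  exact: connect_trans c12 c23.
apply: connect_trans c1a _; apply: connect_sub (cT _ _ aT uT) => s t /=.
by case/and3P=> _ _ st; apply: connect1.
Qed.

(* On a shortest path no label is used twice: a second crossing would be the
   opposite side of the square, and could be replaced by a shortcut. *)
Lemma semitree_graded : semitree G -> graded F.
Proof.
move=> sG A B AF BF; have [u <-] := vertex_of AF; have [v <-] := vertex_of BF => nuv.
have [x [y [C sq]]] := semitree_square sG.
have /ex_minnP[n /walkP[p [sp pp lp]] min_n] : exists n, walk G n u v.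
  have /connectP[p pp lp] := semitree_connected sG u v.
  by exists (size p); apply/walkP; exists p.
case: p => [|w p] in sp pp lp; first by rewrite -lp eqxx in nuv.
have {pp} /andP[uw pp] : adj G u w && path (adj G) w p by [].
have [k wE] := adjP _ _ uw.
exists k; last by rewrite -wE; apply: valP.
rewrite in_symdiff; apply: contraT; rewrite negb_add => /eqP kuv.
have kw : (k \in val w) = (k \notin val u) by rewrite wE in_bitflip eqxx.
(* Since [u] and [v] agree on [k], the walk must cross [k] again; [t] is the first later vertex on
   the same side as [u]. *)
have [s [t [q1 [q2 [pE [ls ks kt st]]]]]] : exists s t q1 q2, p = q1 ++ t :: q2 /\
    [/\ last w q1 = s, (k \in val s) = (k \in val w),
        (k \in val t) = (k \in val u) & adj G s t].
  have kl : (k \in val (last w p)) = (k \in val u) by rewrite (lp : last w p = v).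
  elim: p w pp kl kw {sp lp uw wE} => [|t p IH] w /=.
    by move=> _ ->; case: (_ \in _).
  case/andP=> wt pt kl kw; have [kt|kt] := eqVneq (k \in val t) (k \in val u).
    by exists w, t, [::], p.
  have kt' : (k \in val t) = (k \notin val u) by move: kt; do 2!case: (_ \in _).
  have [s [t' [q1 [q2 [-> [ls ks kt'' st]]]]]] := IH t pt kl kt'.
  by exists s, t', (t :: q1), q2; split=> //; split; rewrite ?ks ?kt' ?kw.
have tq2 : path (adj G) t q2 by have := pp; rewrite pE cat_path => /and3P[].
have lq2 : last t q2 = v by move: lp; rewrite pE /= last_cat.
(* Passing from [u] to [t] in at most one step would give a shorter walk to [v]. *)
have shortcut : ~~ (adj G u t) && (u != t).
  rewrite -negb_or; apply/orP=> ut.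
  have [p' pp' [lp' sp']] : exists2 p', path (adj G) u p' &
      last u p' = v /\ size p' <= (size q2).+1.
    case: ut => [ut|/eqP->]; last by exists q2.
    by exists (t :: q2); rewrite //= ut.
  have /min_n np' : walk G (size p') u v by apply/walkP; exists p'; rewrite lp'.
  have := leq_trans np' sp'.
  by rewrite -sp /= ltnS pE size_cat /= addnS ltnNge leq_addl.
have tE : val t = bitflip k (val s).
  case/adjP: st => j tE; rewrite tE; congr bitflip.
  by move: kt; rewrite tE in_bitflip ks kw; case: eqP => // _; case: (_ \in _).
have ku : val u :\ k \in edges F k by rewrite mem_edges -?wE //; apply: valP.
have ks' : val t :\ k \in edges F k.
  by rewrite mem_edges ?tE ?bitflipK -?tE //; apply: valP.
have eq_t (S : {set X}) : val t :\ k = S :\ k -> (k \in S) = (k \in val u) -> val t = S.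
  move=> tS kS; case: (eq_or_bitflip tS) => // tS'.
  by move: kt; rewrite tS' in_bitflip eqxx kS; case: (_ \in _).
suff : adj G u t \/ u == t by move/orP; rewrite -[_ || _]negbK negb_or shortcut.
have t_u : val t :\ k = val u :\ k -> adj G u t \/ u == t.
  by move=> tu; right; apply/eqP/val_inj/esym/eq_t.
(* This is the case where [k] labels two opposite sides of a square: [u] and [t] lie on the same
   side with respect to [k], so they coincide or differ only in [j]. *)
have t_adj j D : k != j -> j \notin D -> edges F k = [set D; j |: D] ->
    adj G u t \/ u == t.
  move=> kj jD Ek; have t_j : val t :\ k = bitflip j (val u :\ k) ->
      adj G u t \/ u == t.
    rewrite -bitflipD1C 1?eq_sym // => tj; left; apply/adjP; exists j.
    by apply: eq_t => //; rewrite in_bitflip (negPf kj).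
  move: ku ks'; rewrite Ek !in_set2 -bitflip_setU1 // => /orP[]/eqP uD /orP[]/eqP tD.
  - by apply: t_u; rewrite uD.
  - by apply: t_j; rewrite uD.
  - by apply: t_j; rewrite uD bitflipK.
  - by apply: t_u; rewrite uD.
have [xC yC] := squareN sq; case: sq => xy Ex Ey Ez.
have [kx|kx] := eqVneq k x; first by apply: (t_adj y C); rewrite ?kx.
have [ky|ky] := eqVneq k y; first by apply: (t_adj x C); rewrite ?ky // eq_sym.
apply: t_u; move/card_le1P: (Ez k kx ky) => /(_ _ ku (val t :\ k)).
by rewrite ks' inE => /esym/eqP.
Qed.

End OneInclusionGraph.

(** * Additionality 2 as a count *)

Lemma additionality2 (X : finType) (F : {set {set X}}) :
  additionality F = 2%R <-> #|F| = #|ess F|.+2.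
Proof. by rewrite /additionality; split=> *; lia. Qed.

Lemma graded_semitree (X : finType) (F : {set {set X}}) :
  graded F -> #|F| = #|ess F|.+2 -> semitree (one_inclusion_graph F).
Proof.
move=> gF /(square_exists gF)[x [y [C sq]]]; exact: square_semitree sq.
Qed.

Lemma semitree_card (X : finType) (F : {set {set X}}) :
  semitree (one_inclusion_graph F) -> #|F| = #|ess F|.+2.
Proof.
by move=> sF; have [x [y [C]]] := semitree_square sF;
  apply/card_square/semitree_graded.
Qed.

(** * Invariance under flips *)

Section Flip.
Variables (X : finType) (F : {set {set X}}) (D : {set X}).

Lemma flipK : flip (flip F D) D = F.
Proof.
rewrite !flipE -imset_comp -[RHS]imset_id; apply: eq_imset => A /=.
exact: symdiffK.
Qed.

Lemma graded_flip : graded F -> graded (flip F D).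
Proof.
rewrite flipE => gF _ _ /imsetP[A AF ->] /imsetP[B BF ->] nAB.
have [|x xAB xF] := gF A B AF BF; first by apply: contraNneq nAB => ->.
exists x; first by rewrite symdiff_flip.
by rewrite bitflip_symdiff; apply: imset_f.
Qed.

Lemma card_flip : #|flip F D| = #|F|.
Proof. by rewrite flipE card_imset //; apply: (inv_inj (symdiffK D)). Qed.

Lemma ess_flip : ess (flip F D) = ess F.
Proof.
rewrite flipE; apply/setP=> x; apply/mem_ess/mem_ess=> [] [].
  move=> _ [_ [/imsetP[A AF ->] /imsetP[B BF ->]]]; rewrite symdiff_flip.
  by exists A, B.
move=> A [B [AF BF xAB]]; exists (symdiff A D), (symdiff B D).
by split; [apply: imset_f|apply: imset_f|rewrite symdiff_flip].
Qed.

End Flip.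

Lemma graded_uniformly_directed (X : finType) (F : {set {set X}}) :
  graded F -> set0 \in F -> uniformly_directed (one_inclusion_graph F).
Proof.
move=> gF /vertex_of[o oE]; right; exists o => u v uv.
have do_ w : dist (one_inclusion_graph F) o w = Some #|val w|.
  rewrite (well_gradedP _).2 // oE; congr (Some #|pred_of_set _|).
  by apply/setP=> x; rewrite in_symdiff in_set0.
rewrite !do_; exact: arc_card.
Qed.

Theorem theorem3p11 (X : finType) (F : {set {set X}}) (F_neq0 : F != set0) :
  [<-> well_graded F /\ additionality F = 2%R;
       forall D : {set X}, D \in F ->
         uniformly_directed_semitree (one_inclusion_graph (flip F D));
       exists2 D : {set X}, D \in F &
         uniformly_directed_semitree (one_inclusion_graph (flip F D));
       semitree (one_inclusion_graph F)].
Proof.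
tfae.
- case=> /well_gradedP gF /additionality2 cF D DF; split.
    by apply: graded_semitree; [apply: graded_flip|rewrite card_flip ess_flip].
  apply: graded_uniformly_directed; first exact: graded_flip.
  (* The flip sends [D] itself to the empty set, which serves as the root. *)
  rewrite flipE; apply/imsetP; exists D => //.
  by apply/setP=> x; rewrite in_symdiff addbb in_set0.
- by move=> sF; have /set0Pn[D DF] := F_neq0; exists D; last exact: sF.
(* [F] is recovered by flipping once more by [D], so gradedness and the count pass from the flipped
   family to [F]. *)
- case=> D DF [sF _]; rewrite -(flipK F D); apply: graded_semitree.
    exact/graded_flip/semitree_graded.
  by rewrite card_flip ess_flip; apply: semitree_card.
- by move=> sF; split; [apply/well_gradedP/semitree_graded|apply/additionality2/semitree_card].
Qed.
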